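(* Let $X$ be a real Banach space and let $A\colon X\rightrightarrows X^*$ be a maximally monotone linear relation such that $A$ is rectangular. Then $A$ is paramonotone.
   Context: $X$ is a real Banach space with dual $X^*$ and pairing $\langle\cdot,\cdot\rangle$. For a set-valued operator $A\colon X\rightrightarrows X^*$: $\operatorname{gra}A=\{(x,x^* )\in X\times X^*\mid x^*\in Ax\}$, $\operatorname{dom}A=\{x\mid Ax\neq\varnothing\}$, $\operatorname{ran}A=\bigcup_{x\in X}Ax$. $A$ is a linear relation if $\operatorname{gra}A$ is a linear subspace of $X\times X^*$. $A$ is monotone if $\langle x-y,x^*-y^*\rangle\ge 0$ for all $(x,x^* ),(y,y^* )\in\operatorname{gra}A$, and maximally monotone if moreover no monotone operator has a graph properly containing $\operatorname{gra}A$. For a monotone $A$ with nonempty graph, the Fitzpatrick function is $F_A\colon X\times X^*\to\,]-\infty,+\infty]$, $F_A(x,x^* )=\sup_{(a,a^* )\in\operatorname{gra}A}(\langle x,a^*\rangle+\langle a,x^*\rangle-\langle a,a^*\rangle)$, with $\operatorname{dom}F_A=\{(x,x^* )\mid F_A(x,x^* )<+\infty\}$. Such an $A$ is rectangular if $\operatorname{dom}A\times\operatorname{ran}A\subseteq\operatorname{dom}F_A$; it is paramonotone if whenever $(x,x^* ),(y,y^* )\in\operatorname{gra}A$ satisfy $\langle x-y,x^*-y^*\rangle=0$, then $(x,y^* )\in\operatorname{gra}A$ and $(y,x^* )\in\operatorname{gra}A$. *)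

(* Defs.v *)
From HB Require Import structures.
From mathcomp Require Import all_boot all_order all_algebra.
From mathcomp Require Import all_classical all_reals all_analysis.

Set Implicit Arguments.
Unset Strict Implicit.
Unset Printing Implicit Defensive.

Import Order.TTheory GRing.Theory Num.Theory.
Import numFieldNormedType.Exports.

Local Open Scope classical_set_scope.
Local Open Scope ring_scope.

Section dual_space.
Context {R : realType} {X : normedModType R}.

Definition dual_pred : {pred X -> R^o} :=
  [pred f : X -> R | `[< scalar f /\ continuous f >]].

Lemma dual_pred_submod_closed : submod_closed dual_pred.
Proof.
split=> [|a f g /asboolP[lf cf] /asboolP[lg cg]]; apply/asboolP; split.
- by move=> k x y; rewrite /= addr0 mulr0.
- exact: cst_continuous.
- move=> k x y.
  change (a * f (k *: x + y) + g (k *: x + y) =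
          k * (a * f x + g x) + (a * f y + g y)).
  by rewrite lf lg !mulrDr mulrCA addrACA.
- move=> x; apply: (@cvgD _ R^o _ _ _ (a *: f) g); last exact: cg.
  by apply: (@cvgZl_tmp _ R^o); exact: cf.
Qed.

HB.instance Definition _ :=
  GRing.isSubmodClosed.Build R (X -> R^o) dual_pred dual_pred_submod_closed.

End dual_space.

(* The topological dual of X, as a vector space: the subspace of continuous
   linear functionals of the space of all functions X -> R. *)
Record dual (R : realType) (X : normedModType R) :=
  Dual { dual_fun :> X -> R^o; _ : dual_fun \in dual_pred }.

HB.instance Definition _ (R : realType) (X : normedModType R) :=
  [isSub for @dual_fun R X].
HB.instance Definition _ (R : realType) (X : normedModType R) :=
  [Choice of dual X by <:].
HB.instance Definition _ (R : realType) (X : normedModType R) :=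
  [SubChoice_isSubLmodule of dual X by <:].

Section operators.
Context {R : realType} {X : normedModType R}.

Definition pairing (x : X) (f : dual X) : R := f x.

Implicit Types A B : X -> set (dual X).

Definition gra A : set (X * dual X) := [set z | A z.1 z.2].

Definition dom A : set X := [set x | A x !=set0].

Definition ran A : set (dual X) := \bigcup_x A x.

Definition linear_relation A : Prop :=
  submod_closed (mem (gra A)).

Definition monotone A : Prop :=
  forall x xs y ys, gra A (x, xs) -> gra A (y, ys) ->
    0 <= pairing (x - y) (xs - ys).

Definition maximally_monotone A : Prop :=
  monotone A /\ forall B, monotone B -> ~ (gra A `<` gra B).

Definition fitzpatrick A (z : X * dual X) : \bar R :=
  ereal_sup [set (pairing z.1 a.2 + pairing a.1 z.2 - pairing a.1 a.2)%:E
            | a in gra A].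

Definition dom_fitzpatrick A : set (X * dual X) :=
  [set z | (fitzpatrick A z < +oo)%E].

Definition rectangular A : Prop := dom A `*` ran A `<=` dom_fitzpatrick A.

Definition paramonotone A : Prop :=
  forall x xs y ys, gra A (x, xs) -> gra A (y, ys) ->
    pairing (x - y) (xs - ys) = 0 -> gra A (x, ys) /\ gra A (y, xs).

End operators.

(* Main.v *)
(** By linearity it suffices to show that [(0, v)] lies in [gra A] whenever
    [(u, v)] does and [<u, v> = 0].  For [x] in [dom A], the function [F_A] is
    finite at [(x, 0)]; testing its supremum on the line [t (u, v)] bounds
    [t <x, v>] from above for all real [t], whence [<x, v> = 0].  So [(0, v)] is
    monotonically related to [gra A], and maximality concludes. *)
Require Import Defs.
From mathcomp Require Import all_boot all_order all_algebra.
From mathcomp Require Import all_classical all_reals all_analysis.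

Set Implicit Arguments.
Unset Strict Implicit.
Unset Printing Implicit Defensive.

Import Order.TTheory GRing.Theory Num.Theory.
Local Open Scope classical_set_scope.
Local Open Scope ring_scope.

Section dual_pairing.
Context {R : realType} {X : normedModType R}.
Implicit Types (x y : X) (f g : dual X) (k : R).

Lemma pairing_linearl f k x y :
  pairing (k *: x + y) f = k * pairing x f + pairing y f.
Proof. by case: f => f /= /asboolP[fl _]; apply: fl. Qed.

Lemma pairing0l f : pairing (0 : X) f = 0.
Proof.
have := pairing_linearl f (-1) 0 0.
by rewrite scaler0 addr0 mulN1r addNr.
Qed.

Lemma pairingZl f k x : pairing (k *: x) f = k * pairing x f.
Proof. by rewrite -[k *: x]addr0 pairing_linearl pairing0l addr0. Qed.

Lemma pairingNl f x : pairing (- x) f = - pairing x f.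
Proof. by rewrite -scaleN1r pairingZl mulN1r. Qed.

Lemma pairing0r x : pairing x (0 : dual X) = 0.
Proof. by []. Qed.

Lemma pairingZr x k f : pairing x (k *: f) = k * pairing x f.
Proof. by []. Qed.

Lemma pairingBr x f g : pairing x (f - g) = pairing x f - pairing x g.
Proof. by []. Qed.

End dual_pairing.

Section linear_relations.
Context {R : realType} {X : normedModType R}.
Implicit Type A : X -> set (dual X).

Lemma linear_relation0 A : linear_relation A -> gra A (0, 0).
Proof. by case=> /set_mem. Qed.

Lemma linear_relation_comb A k x xs y ys :
  linear_relation A -> gra A (x, xs) -> gra A (y, ys) ->
  gra A (k *: x + y, k *: xs + ys).
Proof.
move=> [_ AL] xA yA.
by have /set_mem := AL k (x, xs) (y, ys) (mem_set xA) (mem_set yA).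
Qed.

Lemma linear_relationZ A k x xs :
  linear_relation A -> gra A (x, xs) -> gra A (k *: x, k *: xs).
Proof.
move=> Alin xA.
by have := linear_relation_comb k Alin xA (linear_relation0 Alin); rewrite !addr0.
Qed.

End linear_relations.

(** Otherwise adjoining [(x, xs)] to [gra A] would give a monotone operator [B] with a strictly
    larger graph. *)
Lemma maximally_monotone_related (R : realType) (X : normedModType R)
    (A : X -> set (dual X)) (x : X) (xs : dual X) :
  maximally_monotone A ->
  (forall a as_, gra A (a, as_) -> 0 <= pairing (a - x) (as_ - xs)) ->
  gra A (x, xs).
Proof.
move=> [Amon Amax] xA; apply: contrapT => nxA.
pose B : X -> set (dual X) := fun a => [set as_ | A a as_ \/ (a, as_) = (x, xs)].
apply: (Amax B) => [a as_ b bs [aA|[-> ->]] [bA|[-> ->]]|].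
- exact: Amon.
- exact: xA.
(* The pairing is unchanged when both arguments change sign, which swaps the two points and reduces
   to [xA]. *)
- rewrite -[x - b]opprB -[xs - bs]opprB -[- (bs - xs)]scaleN1r.
  by rewrite pairingZr pairingNl mulN1r opprK; exact: xA.
- by rewrite subrr pairing0l.
- split; last by move=> BA; apply: nxA; apply: BA; right.
  by move=> [a as_] aA; left.
Qed.

Lemma bounded_multiples_eq0 (R : realType) (c M : R) :
  (forall t, t * c <= M) -> c = 0.
Proof.
move=> cM; apply/eqP; apply: contrapT => /negP c0.
(* For nonzero [c] this multiple equals [M + 1], which exceeds the bound. *)
have := cM ((M + 1) / c).
by rewrite divfK// gerDl ler10.
Qed.

Lemma rectangular_isotropic (R : realType) (X : normedModType R)
    (A : X -> set (dual X)) (u x : X) (us : dual X) :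
  linear_relation A -> rectangular A ->
  gra A (u, us) -> pairing u us = 0 -> dom A x -> pairing x us = 0.
Proof.
move=> Alin Arect uA uus xA.
(* Rectangularity applies because [0] is in [ran A], as [(0, 0)] is in the graph. *)
have Ffin : (fitzpatrick A (x, 0%R) < +oo)%E.
  by apply: Arect; split=> //; exists 0 => //; exact: linear_relation0.
have Fub t : ((t * pairing x us)%:E <= fitzpatrick A (x, 0%R))%E.
  apply: ereal_sup_ubound; exists (t *: u, t *: us).
    exact: linear_relationZ.
  (* The quadratic term [t * (t * pairing u us)] vanishes, so only the term linear in [t]
     survives. *)
  by rewrite pairing0r !pairingZr pairingZl uus !mulr0 subr0 addr0.
case: (fitzpatrick A (x, 0%R)) Ffin Fub => [M| |] // _ Fub.
  apply: (@bounded_multiples_eq0 _ _ M) => t.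
  by rewrite -lee_fin; exact: Fub.
(* The value [-oo] is excluded, since [t = 0] gives the lower bound [0]. *)
by have := Fub 0.
Qed.

Theorem proposition4p5 (R : realType) (X : completeNormedModType R)
    (A : X -> set (dual X)) (Amax : maximally_monotone A)
    (Alin : linear_relation A) (Arect : rectangular A) :
  paramonotone A.
Proof.
move=> x xs y ys xA yA xy0.
have dA : gra A (x - y, xs - ys).
  by have := linear_relation_comb (-1) Alin yA xA; rewrite !scaleN1r ![- _ + _]addrC.
have d0A : gra A (0, xs - ys).
  apply: maximally_monotone_related => // a as_ aA.
  have a0 : pairing a (xs - ys) = 0.
    by apply: rectangular_isotropic dA xy0 _ => //; exists as_.
  (* What remains is [0 <= pairing a as_]: monotonicity of [A] against [(0, 0)]. *)
  rewrite subr0 pairingBr a0.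
  by have := Amax.1 _ _ _ _ aA (linear_relation0 Alin); rewrite !subr0.
split.
  (* Subtracting [(0, xs - ys)] from [(x, xs)] gives [(x, ys)]; adding it to [(y, ys)] gives
     [(y, xs)]. *)
  have := linear_relation_comb (-1) Alin d0A xA.
  by rewrite scaler0 add0r scaleN1r opprB subrK.
have := linear_relation_comb 1 Alin d0A yA.
by rewrite scaler0 add0r scale1r subrK.
Qed.
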